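(* Let $n>2$ be an integer. Let $k'$ be the integer such that $2n+1=k'3^{u}$ with $u\ge 0$ an integer and $\gcd(k',3)=1$, let $k''$ be the integer such that $(2n+1)(2n-1)=k''3^{u'}5^{v'}$ with $u',v'\ge 0$ integers and $\gcd(k'',15)=1$, and let $M=\min\{k',k''\}$. If $a_n=M$ and $a_0=1$, then there exist integers $a_{n-1},a_{n-2},\dots,a_1$ such that the polynomial \[ f(x)=\sum_{j=0}^{n}a_j\frac{x^{2j}}{u_{2j+2}} \] is reducible over $\mathbb{Q}$.
   Context: For $j\ge 0$, $u_{2j+2}=1\times 3\times 5\times\cdots\times(2j+1)$ is the product of the odd positive integers up to $2j+1$ (so $u_2=1$, $u_4=3$, $u_6=15$). *)

(* Defs.v *)
From mathcomp Require Import all_boot all_order all_algebra.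

Set Implicit Arguments.
Unset Strict Implicit.
Unset Printing Implicit Defensive.

Import GRing.Theory.
Local Open Scope ring_scope.

(* [u_even j] is u_(2j+2) = 1 * 3 * ... * (2j+1). *)
Definition u_even (j : nat) : nat := (\prod_(i < j.+1) (2 * i + 1))%N.

(* Only the values a 0, ..., a n matter. *)
Definition f_poly (n : nat) (a : nat -> int) : {poly rat} :=
  \sum_(j < n.+1) ((a j)%:~R / (u_even j)%:R) *: 'X^(2 * j).

(* Over a field, the nonunits of {poly F} other than 0 are the polynomials of
   size > 1, so this is a factorization into two nonconstant factors. *)
Definition reducible_poly (F : fieldType) (p : {poly F}) : Prop :=
  exists g h : {poly F}, [/\ (1 < size g)%N, (1 < size h)%N & p = g * h].

Lemma reducible_polyN (F : fieldType) (p : {poly F}) :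
  p != 0 -> reducible_poly p -> ~ irreducible_poly p.
Proof.
move=> p0 [g [h [sg sh def_p]]] [_ irr].
have [g0 h0] : g != 0 /\ h != 0.
  by apply/andP; rewrite -negb_or -mulf_eq0 -def_p.
have gp : g %= p by apply: irr; [rewrite gtn_eqF | rewrite def_p dvdp_mulr].
move/eqp_size: gp; rewrite def_p size_mul // => /eqP.
by case: (size h) sh => [|[|m]] // _; rewrite !addnS /= -addnS -{1}[size g]addn0 eqn_add2l.
Qed.

(* Main.v *)
Require Import Defs.
From mathcomp Require Import all_boot all_order all_algebra.
From mathcomp Require Import zify ring.

Set Implicit Arguments.
Unset Strict Implicit.
Unset Printing Implicit Defensive.

Import GRing.Theory Num.Theory.

(** With D = u_(2e+2), the monomial x^(2j) is congruent to D^(j / e) x^(2 (j mod e)) modulo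
    x^(2e) - D, and 1 - x^(2e) / u_(2e+2) is a multiple of x^(2e) - D. So f can be made
    divisible by x^(2e) - D as soon as a_n D^(n / e) lies in the ideal generated by the
    (2n+1)!!/(2j+1)!! D^(j / e), where 0 < j < n and j = n mod e. For a_n = k' take e = 1,
    D = 3; the 3-adic valuation of (2n+1)!! is at most n. If k'' < k', then 3 does not
    divide 2n + 1, and for a_n = k'' one takes e = 2, D = 15; the 5-adic valuation of (2n+1)!!
    is at most n / 2, while the prime 3 needs a well-chosen j. *)

(** * Quotients of double factorials *)

(** For [j <= n] this is (2n+1)!!/(2j+1)!!, the factor left on a_j when f is multiplied by
    u_(2n+2). *)
Definition odd_prod (j n : nat) : nat := \prod_(j.+1 <= i < n.+1) (2 * i + 1).

Lemma odd_prod_gt0 j n : 0 < odd_prod j n.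
Proof. by rewrite prodn_gt0 // => i; rewrite addn1. Qed.

Lemma odd_prodnn n : odd_prod n n = 1.
Proof. by rewrite /odd_prod big_geq. Qed.

Lemma odd_prod_cat j k n : j <= k <= n ->
  odd_prod j n = odd_prod j k * odd_prod k n.
Proof. by case/andP=> jk kn; rewrite /odd_prod (@big_cat_nat _ _ _ k.+1). Qed.

Lemma odd_prodS n : odd_prod n n.+1 = 2 * n + 3.
Proof. by rewrite /odd_prod big_nat1; lia. Qed.

Lemma u_evenE n : u_even n = odd_prod 0 n.
Proof.
by rewrite /u_even -(big_mkord xpredT (fun i => 2 * i + 1)) big_ltn // mul1n.
Qed.

Lemma u_even_gt0 n : 0 < u_even n.
Proof. by rewrite u_evenE odd_prod_gt0. Qed.

Lemma u_even_cat j n : j <= n -> u_even n = u_even j * odd_prod j n.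
Proof. by move=> jn; rewrite !u_evenE (@odd_prod_cat 0 j). Qed.

Lemma u_even_dvd_fact n : u_even n %| (2 * n + 1)`!.
Proof.
elim: n => [|n IHn]; first by rewrite u_evenE odd_prodnn dvd1n.
rewrite (@u_even_cat n) // odd_prodS.
have -> : 2 * n.+1 + 1 = (2 * n + 1).+2 by lia.
rewrite !factS mulnA [_ * (2 * n + 1)`!]mulnC; apply: dvdn_mul => //.
by apply: dvdn_mulr; rewrite (_ : (2 * n + 1).+2 = 2 * n + 3) //; lia.
Qed.

(** * Valuations and Bezout coefficients *)

Lemma logn_fact_lt p n : prime p -> 0 < n -> p.-1 * logn p n`! < n.
Proof.
move=> p_pr n0; have p1 := prime_gt1 p_pr; rewrite logn_fact //.
(* The extra term [n %/ p ^ m] carries the induction on Legendre's sum: it pays for the next summand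
   [r], since p r <= q. Strictness persists because either r = 0 and the sum is unchanged, or r > 0
   and the first bound gives it. *)
have : forall m, p.-1 * (\sum_(1 <= k < m.+1) n %/ p ^ k) + n %/ p ^ m <= n /\
                 p.-1 * (\sum_(1 <= k < m.+1) n %/ p ^ k) < n.
  elim=> [|m [IH1 IH2]]; first by rewrite big_geq // muln0 expn0 divn1; lia.
  rewrite big_nat_recr //= expnSr divnMA mulnDr.
  set S := p.-1 * _ in IH1 IH2 *; set q := n %/ p ^ m in IH1 *.
  have := leq_divM q p; set r := q %/ p => hr.
  have hpr : p.-1 * r + r = r * p by rewrite mulnC -mulnSr prednK // ltnW.
  by case: (posnP r) hr hpr => [-> | r0] *; rewrite ?muln0; lia.
by move=> /(_ n) [].
Qed.

Lemma bezout_range n (F : nat -> nat) :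
  exists b : nat -> int,
    (\sum_(j < n) b j * (F j)%:Z = (\big[gcdn/0%N]_(j < n) F j)%:Z)%R.
Proof.
elim: n => [|n [b IHn]]; first by exists (fun=> 0%R); rewrite !big_ord0.
have [u [v uv]] := Bezoutz (\big[gcdn/0%N]_(j < n) F j) (F n).
exists (fun j => if j == n then v else u * b j)%R.
rewrite !big_ord_recr /= eqxx; apply: etrans uv; rewrite -IHn mulr_sumr.
congr (_ + _)%R; apply: eq_bigr => j _.
by rewrite ltn_eqF // mulrA.
Qed.

(** The part of [g] prime to [p] divides [k], so the exponent [a] can be replaced by any bound on
    the valuation of [g]. *)
Lemma dvdn_mul_pexp g k p a m : prime p -> 0 < g -> g %| k * p ^ a ->
  logn p g <= m -> g %| k * p ^ m.
Proof.
move=> p_pr g0 gk gm; have [r cpr def_g] := pfactor_coprime p_pr g0.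
rewrite def_g; apply: dvdn_mul; last exact: dvdn_exp2l.
rewrite -(@Gauss_dvdl _ _ (p ^ a)); last by rewrite coprime_sym coprimeXl.
by apply: dvdn_trans gk; rewrite def_g dvdn_mulr.
Qed.

(** For k <= w, a power p^k dividing a - 2t also divides t, as p is odd; a valuation above w would
    make p^w divide t < p^w. *)
Lemma logn_sub_le p w a t : prime p -> p ^ w %| a -> 2 < p -> 0 < t < p ^ w ->
  2 * t < a -> logn p (a - 2 * t) <= logn p t.
Proof.
move=> p_pr wa p2 /andP[t0 tw] ta.
have c2 k : coprime (p ^ k) 2.
  by rewrite coprimeXl // prime_coprime // dvdn_prime2 //; lia.
have d0 : 0 < a - 2 * t by lia.
have key k : k <= w -> k <= logn p (a - 2 * t) -> p ^ k %| t.
  move=> kw; rewrite -pfactor_dvdn // => kd.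
  have ka : p ^ k %| a by apply: dvdn_trans wa; apply: dvdn_exp2l.
  by move: kd; rewrite dvdn_subr ?(ltnW ta) // Gauss_dvdr.
case: (leqP (logn p (a - 2 * t)) w) => [dw | wd].
  by rewrite -pfactor_dvdn // key.
by have := dvdn_leq t0 (key w (leqnn _) (ltnW wd)); rewrite leqNgt tw.
Qed.

(** The factors are (2m+1) - 2t for 0 <= t <= T; each one with t > 0 has valuation at most that of
    t. *)
Lemma logn_odd_prod_le p w m T : prime p -> p ^ w %| 2 * m + 1 ->
  2 < p -> T < p ^ w -> T < m ->
  logn p (odd_prod (m - T.+1) m) <= logn p (2 * m + 1) + logn p T`!.
Proof.
move=> p_pr wm p2; elim: T => [|T IHT] Tw Tm.
  by rewrite /odd_prod subn1 prednK // big_nat1 leq_addr.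
rewrite (@odd_prod_cat _ (m - T.+1)); last by lia.
rewrite factS !lognM ?odd_prod_gt0 ?fact_gt0 // addnCA leq_add ?IHT ?(ltnW Tw) ?(ltnW Tm) //.
have -> : m - T.+1 = (m - T.+2).+1 by lia.
rewrite odd_prodS.
have -> : 2 * (m - T.+2) + 3 = 2 * m + 1 - 2 * T.+1 by lia.
by apply: (logn_sub_le p_pr wm p2); lia.
Qed.

(* [m! = (m-1)! m] gains exactly [w] at [m = 3 ^ w], so the bound for [m!] improves by [w]. *)
Lemma logn3_fact_pred w : 2 * (logn 3 (3 ^ w).-1`! + w) <= (3 ^ w).-1.
Proof.
have w0 : 0 < 3 ^ w by rewrite expn_gt0.
have := @logn_fact_lt 3 (3 ^ w) isT w0.
rewrite -[in (_`!)](prednK w0) factS prednK // lognM ?fact_gt0 // pfactorK //.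
lia.
Qed.

(** * Reduction modulo x^(2e) - D *)

Lemma dvdp_Xn_sub_red (F : fieldType) (d : F) e j :
  ('X^(2 * e) - d%:P %| 'X^(2 * j) - d ^+ (j %/ e) *: 'X^(2 * (j %% e)))%R.
Proof.
have -> : ('X^(2 * j) = ('X^(2 * e)) ^+ (j %/ e) * 'X^(2 * (j %% e)) :> {poly F})%R.
  by rewrite -exprM -exprD {1}(divn_eq j e); congr (_ ^+ _)%R; lia.
rewrite -mul_polyC polyC_exp -mulrBl subrXX -mulrA.
exact: dvdp_mulIl.
Qed.

Lemma reducible_of_gcd n e k : 0 < e < n -> 0 < k ->
  (\big[gcdn/0%N]_(j < n | (0 < j) && (j == n %[mod e]))
      (odd_prod j n * u_even e ^ (j %/ e))) %| k * u_even e ^ (n %/ e) ->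
  exists a : nat -> int,
    [/\ a n = Posz k, a 0%N = Posz 1 & reducible_poly (f_poly n a)].
Proof.
move=> /andP[e0 en] k0; set D := u_even e.
set P := fun j => (0 < j) && (j == n %[mod e]).
set F := fun j => odd_prod j n * D ^ (j %/ e).
rewrite -/(F _) => /dvdnP[q Kq].
have [b0 Hb0] := bezout_range n (fun j => if P j then F j else 0).
rewrite -(big_mkcond (fun j : 'I_n => P j) (fun j : 'I_n => F j)) in Hb0.
pose b j : int := if j == n then Posz k else
  if P j then (- (q%:Z * b0 j))%R else 0%R.
have b_supp j : b j != 0%R -> 0 < j /\ j = n %[mod e].
  rewrite /b; have [-> _|_] := eqVneq j n; first by split=> //; lia.
  by rewrite /P; case: andP => [[? /eqP]|] //; rewrite eqxx.
have b_sum : (\sum_(j < n.+1) b j * (F j)%:Z = 0)%R.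
  rewrite big_ord_recr /= {2}/b eqxx.
  have -> : (\sum_(j < n) b j * (F j)%:Z =
             - q%:Z * \sum_(j < n) b0 j * (if P j then F j else 0)%:Z)%R.
    rewrite mulr_sumr; apply: eq_bigr => j _; rewrite /b ltn_eqF //.
    by case: (P j); rewrite ?mul0r ?mulr0 // mulrA !mulNr.
  by rewrite Hb0 mulNr -!PoszM /F odd_prodnn mul1n Kq addNr.
(* Adding 1 - x^(2e)/D, a multiple of x^(2e) - D, sets a_0 to 1, since [b 0] is 0; a_n is kept
   because 0 < e < n. *)
pose a j : int := (b j + (j == 0)%:Z - (j == e)%:Z)%R.
have an : a n = Posz k by rewrite /a /b eqxx !gtn_eqF ?(ltn_trans e0) // addr0 subr0.
have a0 : a 0 = Posz 1.
  have -> : a 0 = (b 0 + 1)%R by rewrite /a eqxx (ltn_eqF e0) subr0.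
  by rewrite [b 0](_ : _ = 0%R) //; apply/eqP; case: eqP => // /eqP /b_supp[].
exists a; split=> //.
have u_neq0 j : ((u_even j)%:R != 0 :> rat)%R by rewrite pnatr_eq0 -lt0n u_even_gt0.
pose d : rat := (D%:R)%R.
have red0 : (\sum_(j < n.+1) ((a j)%:~R / (u_even j)%:R) *:
               (d ^+ (j %/ e) *: 'X^(2 * (j %% e))) = 0 :> {poly rat})%R.
  pose t j : {poly rat} := ((u_even j)%:R^-1 *: (d ^+ (j %/ e) *: 'X^(2 * (j %% e))))%R.
  have tb j : ((b j)%:~R *: t j =
     ((u_even n)%:R^-1 * (b j * (F j)%:Z)%:~R) *: 'X^(2 * (n %% e)))%R \/ n < j.
    case: (leqP j n) => jn; [left | by right].
    rewrite /t; have [-> | /b_supp[_ ->]] := eqVneq (b j) 0%R.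
      by rewrite mul0r mulr0 !scale0r.
    rewrite !scalerA; congr (_ *: _)%R.
    rewrite (u_even_cat jn) rmorphM /= /F PoszM rmorphM /= -!pmulrn !natrM natrX -/d.
    have := u_neq0 j; have : ((odd_prod j n)%:R != 0 :> rat)%R.
      by rewrite pnatr_eq0 -lt0n odd_prod_gt0.
    by move=> *; field; apply/andP.
  have t0e : t 0 = t e.
    by rewrite /t div0n mod0n divnn e0 modnn expr0 expr1 !scale1r !scalerA /d
      mulVf // u_evenE odd_prodnn invr1.
  transitivity (\sum_(j < n.+1) (b j)%:~R *: t j +
     (\sum_(j < n.+1) (j == 0 :> nat)%:R *: t j -
      \sum_(j < n.+1) (j == e :> nat)%:R *: t j))%R.
    rewrite -sumrB -big_split /=; apply: eq_bigr => j _.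
    rewrite -scalerBl -scalerDl -scalerA -/(t j); congr (_ *: _)%R.
    by rewrite /a -addrA rmorphD rmorphB.
  have pick i : i < n.+1 -> (\sum_(j < n.+1) (j == i :> nat)%:R *: t j = t i)%R.
    move=> ilt; rewrite (bigD1 (Ordinal ilt)) //= eqxx scale1r big1 ?addr0 // => j ji.
    by rewrite (negPf ji : (j == i :> nat) = false) scale0r.
  rewrite !pick ?t0e ?subrr ?addr0 //; last by lia.
  transitivity (((u_even n)%:R^-1 * (\sum_(j < n.+1) b j * (F j)%:Z)%:~R) *:
                  'X^(2 * (n %% e)) : {poly rat})%R.
    rewrite rmorph_sum mulr_sumr scaler_suml; apply: eq_bigr => j _.
    by case: (tb j) => // ; rewrite ltnNge -ltnS ltn_ord.
  by rewrite b_sum mulr0 scale0r.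
have dvdf : ('X^(2 * e) - d%:P %| f_poly n a)%R.
  rewrite -[f_poly n a]subr0 -red0 -sumrB.
  elim/big_rec: _ => [|j p _ dp]; first exact: dvdp0.
  by rewrite dvdp_add // -scalerBr -mul_polyC dvdp_mull ?dvdp_Xn_sub_red.
have size_d : size ('X^(2 * e) - d%:P)%R = (2 * e).+1 by rewrite size_XnsubC; lia.
(* The nonzero leading term gives f degree at least 2n > 2e, so the cofactor is not constant. *)
have size_f : 2 * n < size (f_poly n a).
  rewrite ltnNge; apply/negP => /leq_sizeP/(_ _ (leqnn _))/eqP; apply/negP.
  rewrite /f_poly coef_sum big_ord_recr /= big1 => [|j _].
    by rewrite add0r coefZ coefXn eqxx mulr1 an mulf_neq0 ?invr_neq0 // pnatr_eq0 -lt0n.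
  by rewrite coefZ coefXn (_ : _ == _ = false) ?mulr0 //; apply/eqP; have := ltn_ord j; lia.
have [h def_f] := dvdpP _ _ dvdf.
exists h, ('X^(2 * e) - d%:P)%R; split=> //; last by rewrite size_d; lia.
have := size_polyMleq h ('X^(2 * e) - d%:P); rewrite -def_f size_d => /(leq_trans size_f).
by set sh := size h; move: sh => sh; lia.
Qed.

(** * The cases D = 3 and D = 15 *)

Lemma logn_u_even_le p n : prime p -> p.-1 * logn p (u_even n) <= 2 * n.
Proof.
move=> p_pr; have p1 := prime_gt1 p_pr.
have := @logn_fact_lt p (2 * n + 1) p_pr; rewrite addn1 => /(_ isT).
rewrite ltnS => h; apply: leq_trans h; rewrite leq_pmul2l; last by lia.
by rewrite -addn1 dvdn_leq_log ?fact_gt0 ?u_even_dvd_fact.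
Qed.

Lemma u_even1 : u_even 1 = 3.
Proof. by rewrite /u_even !big_ord_recl big_ord0. Qed.

Lemma u_even2 : u_even 2 = 15.
Proof. by rewrite /u_even !big_ord_recl big_ord0. Qed.

Lemma odd_prod_pred n : 0 < n -> odd_prod n.-1 n = 2 * n + 1.
Proof. by case: n => // n _; rewrite odd_prodS; lia. Qed.

Lemma odd_prod_pred2 n : 1 < n -> odd_prod (n - 2) n = (2 * n + 1) * (2 * n - 1).
Proof.
case: n => [|[|n]] // _; rewrite subn2 (@odd_prod_cat _ n.+1) ?odd_prodS; last by lia.
by rewrite mulnC; congr (_ * _); lia.
Qed.

Lemma reducible_quadratic_factor n k' u : 2 < n -> 2 * n + 1 = k' * 3 ^ u ->
  exists a : nat -> int,
    [/\ a n = Posz k', a 0%N = Posz 1 & reducible_poly (f_poly n a)].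
Proof.
move=> n2 hk'; apply: (@reducible_of_gcd n 1); [lia | by case: k' hk'; lia|].
rewrite u_even1 divn1; set g := \big[_/_]_(_ < _ | _) _.
have g_dvd j (jn : j < n) : 0 < j -> g %| odd_prod j n * 3 ^ j.
  move=> j0; rewrite -{2}(divn1 j).
  by apply: (@biggcdn_inf _ (Ordinal jn)); rewrite //= j0 !modn1.
(* The generator of index 1 is u_(2n+2) itself, whence the 3-adic valuation of [g] is at most n. *)
have g_u : g %| u_even n.
  rewrite (@u_even_cat 1 n) ?u_even1 1?mulnC; last by lia.
  by apply: g_dvd; lia.
(* The generator of index n - 1 is (2n+1) 3^(n-1) = k' 3^(u+n-1). *)
apply: (@dvdn_mul_pexp _ _ _ (u + n.-1)) => //.
- by apply: dvdn_gt0 g_u; rewrite u_even_gt0.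
- by rewrite expnD mulnA -hk' -odd_prod_pred; [apply: g_dvd|]; lia.
- have := @logn_u_even_le 3 n isT; have := dvdn_leq_log 3 (u_even_gt0 n) g_u; lia.
Qed.

(** Suppose 3 divides 2n+1. If 5 does not, k' is prime to 15, so k' <= k''. If 5 does, 2n-1 is prime
    to 15, so 2n-1 <= k'' < k', against 3k' <= 2n+1. *)
Lemma not_dvd3_of_lt n k' k'' u u' v' : 2 < n -> 2 * n + 1 = k' * 3 ^ u ->
  coprime k' 3 ->
  (2 * n + 1) * (2 * n - 1) = k'' * 3 ^ u' * 5 ^ v' -> k'' < k' ->
  ~~ (3 %| 2 * n + 1).
Proof.
move=> n2 hk' k3 hk'' lt_k; apply/negP => n3.
have k''0 : 0 < k'' by case: k'' hk'' {lt_k} => //; lia.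
have dvd_k'' m : coprime m 3 -> coprime m 5 ->
    m %| (2 * n + 1) * (2 * n - 1) -> m <= k''.
  move=> m3 m5; rewrite hk'' !Gauss_dvdl ?coprimeXr //; exact: dvdn_leq.
have n5 : 5 %| 2 * n + 1.
  apply/negPn/negP => n5; move: lt_k; rewrite ltnNge dvd_k'' //.
    rewrite coprime_sym prime_coprime //; apply: contra n5 => k5.
    by rewrite hk' dvdn_mulr.
  by rewrite dvdn_mulr // hk' dvdn_mulr.
have : 2 * n - 1 <= k''.
  apply: dvd_k''; last exact: dvdn_mull.
    by rewrite coprime_sym prime_coprime //; lia.
  by rewrite coprime_sym prime_coprime //; lia.
case: u hk' => [|u hk'].
  2: by have : k' * 3 ^ 1 <= k' * 3 ^ u.+1; [rewrite leq_mul2l leq_exp2l // orbT | lia].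
by rewrite muln1 => hk'; move: k3; rewrite coprime_sym prime_coprime // -hk' n3.
Qed.

(* The product of the [T + 1] odd numbers ending at [2 n - 1] has the [3]-adic valuation of
   [(2 n - 1) T!], and for [T = 3 ^ (w - 1) - 1], [w] being the valuation of [2 n - 1], this
   is at most [(T + 2) / 2]. *)
Lemma log3_odd_prod_le n : 2 < n -> ~~ (3 %| 2 * n + 1) ->
  exists j, [/\ 0 < j < n, j = n %[mod 2] &
                logn 3 (odd_prod j n) + j %/ 2 <= n %/ 2].
Proof.
move=> n2 n3; set w := logn 3 (2 * n - 1).
have def_m : 2 * n.-1 + 1 = 2 * n - 1 by lia.
have w_dvd : 3 ^ w %| 2 * n.-1 + 1 by rewrite def_m pfactor_dvdnn.
have [T [T_even Tn Tw T_fact]] : exists T,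
    [/\ ~~ odd T, T + 2 < n, T < 3 ^ w & 2 * (logn 3 T`! + w.-1) <= T].
  have w_le : 3 ^ w <= 2 * n - 1 by rewrite -def_m dvdn_leq // addn1.
  have w0 : 0 < 3 ^ w.-1 by rewrite expn_gt0.
  (* For w = 0 the truncated predecessor gives T = 0. *)
  exists (3 ^ w.-1).-1; split; last exact: logn3_fact_pred.
  - by rewrite -oddS prednK // oddX orbT.
  - move: w_le w0; case: (w) => [|[|w1]] /=; rewrite ?expnS ?expn0; clear -n2; lia.
  - by rewrite prednK // leq_exp2l // leq_pred.
(* The product now consists of 2n+1, prime to 3, and the T + 1 odd numbers ending at 2n-1; as T is
   even, j has the parity of n. *)
exists (n - (T + 2)); split; [lia | by clear -T_even Tn; lia |].
have Tn1 : T < n.-1 by clear -Tn; lia.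
rewrite (@odd_prod_cat _ n.-1); last by clear -Tn; lia.
rewrite odd_prod_pred; last by clear -n2; lia.
rewrite lognM ?odd_prod_gt0 //; last by rewrite addn1.
rewrite (lognE 3 (2 * n + 1)) (negPf n3) !andbF addn0.
have := logn_odd_prod_le (isT : prime 3) w_dvd isT Tw Tn1.
rewrite (_ : n.-1 - T.+1 = n - (T + 2)); last by clear -Tn; lia.
rewrite def_m -/w; move: (logn 3 _) (logn 3 T`!) T_fact => x y.
by clear -Tn T_even; lia.
Qed.

Lemma reducible_quartic_factor n k'' u' v' : 2 < n ->
  (2 * n + 1) * (2 * n - 1) = k'' * 3 ^ u' * 5 ^ v' -> ~~ (3 %| 2 * n + 1) ->
  exists a : nat -> int,
    [/\ a n = Posz k'', a 0%N = Posz 1 & reducible_poly (f_poly n a)].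
Proof.
move=> n2 hk'' n3; apply: (@reducible_of_gcd n 2); [lia | by case: k'' hk''; lia|].
rewrite u_even2; set g := \big[_/_]_(_ < _ | _) _.
have g_dvd j (jn : j < n) : 0 < j -> j = n %[mod 2] ->
    g %| odd_prod j n * 15 ^ (j %/ 2).
  move=> j0 jm.
  by apply: (@biggcdn_inf _ (Ordinal jn)); rewrite //= j0 jm eqxx.
have g_u : g %| u_even n.
  have [n1 | n1] := eqVneq (n %% 2) 1.
    rewrite (@u_even_cat 1 n); last by lia.
    by apply: dvdn_mull; rewrite -[odd_prod 1 n]muln1; apply: (g_dvd 1); lia.
  rewrite (@u_even_cat 2 n) ?u_even2 1?mulnC; last by lia.
  by apply: (g_dvd 2); lia.
have g0 : 0 < g by apply: dvdn_gt0 g_u; rewrite u_even_gt0.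
(* The generator of index n - 2 contains (2n+1)(2n-1), which fixes the part of [g] prime to 15. *)
have g_k : g %| k'' * 5 ^ (v' + (n - 2) %/ 2) * 3 ^ (u' + (n - 2) %/ 2).
  rewrite (_ : _ * _ = odd_prod (n - 2) n * 15 ^ ((n - 2) %/ 2)); last first.
    by rewrite odd_prod_pred2 ?hk''; [rewrite !expnD (expnMn 3 5); ring | lia].
  by apply: g_dvd; lia.
have log5 : logn 5 g <= n %/ 2.
  have := @logn_u_even_le 5 n isT; have := dvdn_leq_log 5 (u_even_gt0 n) g_u; lia.
(* Here u_(2n+2) would only give the bound n, so a generator with few factors 3 is used instead. *)
have log3 : logn 3 g <= n %/ 2.
  have [j [/andP[j0 jn] jm le_j]] := log3_odd_prod_le n2 n3.
  apply: leq_trans le_j.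
  have -> : logn 3 (odd_prod j n) + j %/ 2 = logn 3 (odd_prod j n * 15 ^ (j %/ 2)).
    by rewrite lognM ?odd_prod_gt0 ?expn_gt0 // lognX muln1.
  by rewrite dvdn_leq_log ?g_dvd // muln_gt0 odd_prod_gt0 expn_gt0.
rewrite (expnMn 3 5) mulnA.
apply: (@dvdn_mul_pexp _ _ _ (v' + (n - 2) %/ 2)) => //.
rewrite mulnAC; exact: (@dvdn_mul_pexp _ _ _ (u' + (n - 2) %/ 2)).
Qed.

Theorem mainTheorem2 (n k' k'' u u' v' : nat)
    (hn : (2 < n)%N)
    (hk' : (2 * n + 1 = k' * 3 ^ u)%N)
    (hk'3 : gcdn k' 3 = 1%N)
    (hk'' : ((2 * n + 1) * (2 * n - 1) = k'' * 3 ^ u' * 5 ^ v')%N)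
    (hk''15 : gcdn k'' 15 = 1%N) :
  exists a : nat -> int,
    [/\ a n = Posz (minn k' k''), a 0%N = Posz 1 & reducible_poly (f_poly n a)].
Proof.
case: (leqP k' k'') => [_ | lt_k]; first exact: reducible_quadratic_factor hn hk'.
exact: reducible_quartic_factor hn hk'' (not_dvd3_of_lt hn hk' (introT eqP hk'3) hk'' lt_k).
Qed.
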